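(* Work in homotopy type theory with a weak Tarski universe, and let $V$ be the type of iterative sets with the type-theoretic interpretation $\llbracket\cdot\rrbracket$ of set-theoretic formulae. Then every basic axiom of constructive Zermelo–Fraenkel set theory (CZF) is valid in the interpretation. Explicitly, each instance of each of the following is valid (i.e. the interpretation of its universal closure is an inhabited type): (1) the defining schemes of the restricted quantifiers: $(\forall x\in y)\phi(x)\Leftrightarrow\forall x\,(x\in y\Rightarrow\phi(x))$ and $(\exists x\in y)\phi(x)\Leftrightarrow\exists x\,(x\in y\wedge\phi(x))$; (2) the equality axioms: $x\doteq y\Leftrightarrow\forall z\,(z\in x\Leftrightarrow z\in y)$ (extensionality) and $x\doteq y\wedge y\in z\Rightarrow x\in z$; (3) pairing: $\exists z\,(x\in z\wedge y\in z)$; (4) union: $\exists z\,(\forall y\in x)(\forall u\in y)(u\in z)$; (5) restricted separation: for each restricted formula $\phi$ (all of whose quantifiers are restricted), $\exists z\,[(\forall y\in z)(y\in x\wedge\phi(y))\wedge(\forall y\in x)(\phi(y)\Rightarrow y\in z)]$; (6) subset collection: $\exists c\,\forall u\,[(\forall x\in a)(\exists y\in b)\,\phi(x,y)\Rightarrow(\exists d\in c)\,\phi'(a,d)]$, where $u$ may occur free in $\phi$; (7) set induction: $\forall y\,[(\forall x\in y)\,\phi(x)\Rightarrow\phi(y)]\Rightarrow\forall x\,\phi(x)$; (8) strong collection: $(\forall x\in a)\exists y\,\phi(x,y)\Rightarrow\exists b\,\phi'(a,b)$; (9) strong infinity: $\exists z\,\mathrm{Nat}(z)$. Here $\phi'(a,b)$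 denotes $(\forall x\in a)(\exists y\in b)\,\phi(x,y)\wedge(\forall y\in b)(\exists x\in a)\,\phi(x,y)$; $\mathrm{Zero}(x)$ is $(\forall y\in x)\bot$; $\mathrm{Succ}(x,y)$ is $(\forall z\in x)(z\in y)\wedge x\in y\wedge(\forall z\in y)(z\in x\vee z\doteq x)$; and $\mathrm{Nat}(z)$ is $(\forall x\in z)(\mathrm{Zero}(x)\vee(\exists y\in z)\mathrm{Succ}(y,x))\wedge(\exists x\in z)\mathrm{Zero}(x)\wedge(\forall y\in z)(\exists x\in z)\mathrm{Succ}(y,x)$. Bound set variables asserted to exist ($z$, $c$, $b$) do not occur free in $\phi$.
   Context: Ambient theory. Homotopy type theory with a weak Tarski universe: intensional Martin-Löf type theory with dependent products $\Pi$ (with definitional $\beta$ and $\eta$), dependent sums $\Sigma$ (projections $\mathsf p,\mathsf q$), identity types $Id$, binary sums $+$, finite types $\mathbf N_k$, natural numbers $\mathbf N$, $W$-types, and function extensionality (for $f,g:(\Pi x:A)B(x)$ the canonical map $Id(f,g)\to(\Pi x:A)Id(f(x),g(x))$ is an equivalence). $\mathit{Equiv}(A,B)$ is the type of maps $f:A\to B$ with a left inverse and a right inverse up to pointwise identity. The weak Tarski universe is a type $U$ of names with a family $El(a)$ ($a:U$), closed under names for all type constructors: $\pi(a,b),\sigma(a,b),w(a,b):U$ for $a:U$, $b(x):U$ ($x:El(a)$); $i_a(b,c):U$ for $b,c:El(a)$; $plus(a,b):U$; $n:U$; $n_k:U$. Instead of definitional equalities there are only given equivalences: $El(\pi(a,b))\simeq(\Pi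 x:El(a))El(b(x))$, $El(\sigma(a,b))\simeq(\Sigma x:El(a))El(b(x))$, $El(w(a,b))\simeq(Wx:El(a))El(b(x))$, $El(i_a(b,c))\simeq Id_{El(a)}(b,c)$, $El(plus(a,b))\simeq El(a)+El(b)$, $El(n)\simeq\mathbf N$, $El(n_k)\simeq\mathbf N_k$. (Homotopy type theory also includes univalence: the canonical map $Id_U(a,b)\to\mathit{Equiv}(El(a),El(b))$ is an equivalence.) Iterative sets. $V:=(Wx:U)El(x)$, with canonical elements $\mathsf{sup}(a,f)$, $a:U$, $f:El(a)\to V$. For $\alpha:V$ there are $\overline\alpha:U$ and $\tilde\alpha:El(\overline\alpha)\to V$, defined by recursion, with $\overline{\mathsf{sup}(a,f)}=a$ and $\widetilde{\mathsf{sup}(a,f)}=f$. Extensional equality $\alpha\doteq\beta$ is the type defined by double transfinite recursion on $V$ by $(\mathsf{sup}(a,f)\doteq\mathsf{sup}(b,g)):=(\Pi x:El(a))(\Sigma y:El(b))(f(x)\doteq g(y))\times(\Pi y:El(b))(\Sigma x:El(a))(f(x)\doteq g(y))$. Language and interpretation. The language of CZF is first order, with logical symbols $\bot,\wedge,\vee,\Rightarrow,\forall x,\exists x$, primitive restricted quantifiers $\forall x\in y$, $\exists x\in y$, and relation symbols $\in$ and equality (written $\doteq$). $\mathcal L_V$ adds a constant for each $\alpha:V$. The interpretation is: $\llbracket\alpha\doteq\beta\rrbracket=(\alpha\doteq\beta)$; $\llbracket\alpha\in\beta\rrbracket=(\Sigma y:El(\overline\beta))(\alpha\doteq\tilde\beta(y))$;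 $\llbracket\bot\rrbracket=\mathbf N_0$; $\Rightarrow,\wedge,\vee$ are interpreted by $\to,\times,+$; $\llbracket(\forall x\in\alpha)\phi(x)\rrbracket=(\Pi x:El(\overline\alpha))\llbracket\phi(\tilde\alpha(x))\rrbracket$; $\llbracket(\exists x\in\alpha)\phi(x)\rrbracket=(\Sigma x:El(\overline\alpha))\llbracket\phi(\tilde\alpha(x))\rrbracket$; $\llbracket\forall x\,\phi(x)\rrbracket=(\Pi\alpha:V)\llbracket\phi(\alpha)\rrbracket$; $\llbracket\exists x\,\phi(x)\rrbracket=(\Sigma\alpha:V)\llbracket\phi(\alpha)\rrbracket$. A formula is valid iff the interpretation of its universal closure is inhabited. *)

(* Defs.v *)
From Stdlib Require Import List Bool PeanoNat Vectors.Fin.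
Import ListNotations.

Set Implicit Arguments.
Unset Strict Implicit.
Unset Printing Implicit Defensive.

(** * Homotopy type theory with a weak Tarski universe

    The ambient type theory is that of Rocq: dependent products, [sigT], [prod],
    [sum], [Empty_set], [Fin.t k] and [nat].  The identity type is redeclared in
    [Type], because Stdlib's [eq] lives in the impredicative sort [Prop]. *)

Inductive Id {A : Type} (a : A) : A -> Type := refl : Id a a.

Inductive W (A : Type) (B : A -> Type) : Type :=
  sup : forall a : A, (B a -> W B) -> W B.
Arguments sup {A B} a f.

Definition IsEquiv {A B : Type} (f : A -> B) : Type :=
  ({g : B -> A & forall x : A, Id (g (f x)) x} *
   {h : B -> A & forall y : B, Id (f (h y)) y})%type.

Definition Equiv (A B : Type) : Type := {f : A -> B & IsEquiv f}.

Definition id_equiv (A : Type) : Equiv A A :=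
  existT _ (fun x => x)
    (existT _ (fun x => x) (fun x => refl x),
     existT _ (fun x => x) (fun x => refl x)).

Definition happly {A : Type} {B : A -> Type} (f g : forall x : A, B x)
  (p : Id f g) : forall x : A, Id (f x) (g x) :=
  match p in Id _ h return forall x : A, Id (f x) (h x) with
  | refl _ => fun x => refl (f x)
  end.

Definition FunExt : Type :=
  forall (A : Type) (B : A -> Type) (f g : forall x : A, B x),
    IsEquiv (@happly A B f g).

Record WeakTarskiUniverse : Type := {
  U : Type;
  El : U -> Type;
  pi_ : forall a : U, (El a -> U) -> U;
  sigma_ : forall a : U, (El a -> U) -> U;
  w_ : forall a : U, (El a -> U) -> U;
  i_ : forall a : U, El a -> El a -> U;
  plus_ : U -> U -> U;
  n_ : U;
  fin_ : nat -> U;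
  El_pi : forall (a : U) (b : El a -> U),
    Equiv (El (pi_ b)) (forall x : El a, El (b x));
  El_sigma : forall (a : U) (b : El a -> U),
    Equiv (El (sigma_ b)) {x : El a & El (b x)};
  El_w : forall (a : U) (b : El a -> U),
    Equiv (El (w_ b)) (W (fun x : El a => El (b x)));
  El_i : forall (a : U) (b c : El a), Equiv (El (i_ b c)) (Id b c);
  El_plus : forall a b : U, Equiv (El (plus_ a b)) (El a + El b);
  El_n : Equiv (El n_) nat;
  El_fin : forall k : nat, Equiv (El (fin_ k)) (Fin.t k)
}.

Definition idtoequiv (T : WeakTarskiUniverse) (a b : U T) (p : Id a b) :
  Equiv (El a) (El b) :=
  match p in Id _ c return Equiv (El a) (El c) with
  | refl _ => id_equiv (El a)
  end.

Definition Univalence (T : WeakTarskiUniverse) : Type :=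
  forall a b : U T, IsEquiv (@idtoequiv T a b).

(** * Iterative sets *)

Definition V (T : WeakTarskiUniverse) : Type := W (@El T).

Definition bar {T : WeakTarskiUniverse} (alpha : V T) : U T :=
  match alpha with sup a _ => a end.

Definition tilde {T : WeakTarskiUniverse} (alpha : V T) :
  El (bar alpha) -> V T :=
  match alpha return El (bar alpha) -> V T with sup _ f => f end.

Fixpoint doteq {T : WeakTarskiUniverse} (alpha beta : V T) {struct alpha} :
  Type :=
  match alpha, beta with
  | sup a f, sup b g =>
      ((forall x : El a, {y : El b & doteq (f x) (g y)}) *
       (forall y : El b, {x : El a & doteq (f x) (g y)}))%type
  end.

(** * The language of set theory

    Variables are named by natural numbers; [C] is the type of constants, so
    that [formula Empty_set] is the language of CZF and [formula (V T)] is
    [L_V].  In [fballin x t p] and [fbexin x t p] the variable [x] is bound in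
    [p] but not in [t]. *)

Inductive term (C : Type) : Type :=
| var (x : nat)
| cst (c : C).
Arguments var {C} x.
Arguments cst {C} c.

Coercion var : nat >-> term.

Inductive formula (C : Type) : Type :=
| feq (s t : term C)
| fmem (s t : term C)
| fbot
| fconj (p q : formula C)
| fdisj (p q : formula C)
| fimp (p q : formula C)
| fall (x : nat) (p : formula C)
| fex (x : nat) (p : formula C)
| fballin (x : nat) (t : term C) (p : formula C)
| fbexin (x : nat) (t : term C) (p : formula C).
Arguments fbot {C}.

Declare Scope formula_scope.
Delimit Scope formula_scope with F.
Bind Scope formula_scope with formula.

Notation "s ≐ t" := (feq s t) (at level 70, no associativity) : formula_scope.
Notation "s ∈ t" := (fmem s t) (at level 70, no associativity) : formula_scope.
Notation "⊥" := fbot (at level 0) : formula_scope.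
Notation "p ∧ q" := (fconj p q)
  (at level 80, right associativity) : formula_scope.
Notation "p ∨ q" := (fdisj p q)
  (at level 85, right associativity) : formula_scope.
Notation "p ⇒ q" := (fimp p q)
  (at level 99, right associativity, q at level 200) : formula_scope.
Notation "p ⇔ q" := (fconj (fimp p q) (fimp q p))
  (at level 95, no associativity) : formula_scope.
Notation "∀ x , p" := (fall x p)
  (at level 200, x at level 60, p at level 200) : formula_scope.
Notation "∃ x , p" := (fex x p)
  (at level 200, x at level 60, p at level 200) : formula_scope.
Notation "∀ x ∈ t , p" := (fballin x t p)
  (at level 200, x at level 60, t at level 60, p at level 200) : formula_scope.
Notation "∃ x ∈ t , p" := (fbexin x t p)
  (at level 200, x at level 60, t at level 60, p at level 200) : formula_scope.

Definition fv_term {C : Type} (t : term C) : list nat :=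
  match t with var x => [x] | cst _ => [] end.

Fixpoint fv {C : Type} (p : formula C) : list nat :=
  match p with
  | feq s t | fmem s t => fv_term s ++ fv_term t
  | fbot => []
  | fconj q r | fdisj q r | fimp q r => fv q ++ fv r
  | fall x q | fex x q => remove Nat.eq_dec x (fv q)
  | fballin x t q | fbexin x t q => fv_term t ++ remove Nat.eq_dec x (fv q)
  end.

Definition univ_closure {C : Type} (p : formula C) : formula C :=
  fold_right (@fall C) p (nodup Nat.eq_dec (fv p)).

Fixpoint restricted {C : Type} (p : formula C) : bool :=
  match p with
  | feq _ _ | fmem _ _ | fbot => true
  | fconj q r | fdisj q r | fimp q r => restricted q && restricted r
  | fall _ _ | fex _ _ => false
  | fballin _ _ q | fbexin _ _ q => restricted q
  end.

Definition subst_term {C : Type} (x y : nat) (t : term C) : term C :=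
  match t with
  | var z => if Nat.eqb z x then var y else var z
  | cst c => cst c
  end.

(** [subst x y p] replaces the free occurrences of [x] in [p] by [y]; it does
    not rename bound variables, and is correct only under [free_for x y p]. *)
Fixpoint subst {C : Type} (x y : nat) (p : formula C) : formula C :=
  match p with
  | feq s t => feq (subst_term x y s) (subst_term x y t)
  | fmem s t => fmem (subst_term x y s) (subst_term x y t)
  | fbot => fbot
  | fconj q r => fconj (subst x y q) (subst x y r)
  | fdisj q r => fdisj (subst x y q) (subst x y r)
  | fimp q r => fimp (subst x y q) (subst x y r)
  | fall z q => fall z (if Nat.eqb z x then q else subst x y q)
  | fex z q => fex z (if Nat.eqb z x then q else subst x y q)
  | fballin z t q =>
      fballin z (subst_term x y t) (if Nat.eqb z x then q else subst x y q)
  | fbexin z t q =>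
      fbexin z (subst_term x y t) (if Nat.eqb z x then q else subst x y q)
  end.

(** No free occurrence of [x] in [p] lies in the scope of a quantifier
    binding [y]. *)
Fixpoint free_for {C : Type} (x y : nat) (p : formula C) : Prop :=
  match p with
  | feq _ _ | fmem _ _ | fbot => True
  | fconj q r | fdisj q r | fimp q r => free_for x y q /\ free_for x y r
  | fall z q | fex z q | fballin z _ q | fbexin z _ q =>
      ~ In x (remove Nat.eq_dec z (fv q)) \/ (z <> y /\ free_for x y q)
  end.

(** * The axioms of CZF

    The auxiliary predicates take the names of their bound variables as
    leading arguments. *)

(** [fprime x y p a b] is [φ'(a,b)] for [φ(x,y)] the formula [p]. *)
Definition fprime {C : Type} (x y : nat) (p : formula C) (a b : nat) :
  formula C :=
  ((∀ x ∈ a, ∃ y ∈ b, p) ∧ (∀ y ∈ b, ∃ x ∈ a, p))%F.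

Definition Zero {C : Type} (y x : nat) : formula C := (∀ y ∈ x, ⊥)%F.

Definition Succ {C : Type} (z x y : nat) : formula C :=
  ((∀ z ∈ x, z ∈ y) ∧ x ∈ y ∧ (∀ z ∈ y, (z ∈ x ∨ z ≐ x)))%F.

Definition IsNat {C : Type} (w x y z : nat) : formula C :=
  ((∀ x ∈ z, (Zero w x ∨ (∃ y ∈ z, Succ w y x))) ∧
   (∃ x ∈ z, Zero w x) ∧
   (∀ y ∈ z, ∃ x ∈ z, Succ w y x))%F.

Inductive CZF_axiom {C : Type} : formula C -> Type :=
| ax_forall_in (x y : nat) (p : formula C) :
    NoDup [x; y] ->
    CZF_axiom ((∀ x ∈ y, p) ⇔ (∀ x, x ∈ y ⇒ p))%F
| ax_exists_in (x y : nat) (p : formula C) :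
    NoDup [x; y] ->
    CZF_axiom ((∃ x ∈ y, p) ⇔ (∃ x, x ∈ y ∧ p))%F
| ax_extensionality (x y z : nat) :
    NoDup [x; y; z] ->
    CZF_axiom (x ≐ y ⇔ (∀ z, z ∈ x ⇔ z ∈ y))%F
| ax_eq_mem (x y z : nat) :
    NoDup [x; y; z] ->
    CZF_axiom (x ≐ y ∧ y ∈ z ⇒ x ∈ z)%F
| ax_pairing (x y z : nat) :
    NoDup [x; y; z] ->
    CZF_axiom (∃ z, x ∈ z ∧ y ∈ z)%F
| ax_union (x y z u : nat) :
    NoDup [x; y; z; u] ->
    CZF_axiom (∃ z, ∀ y ∈ x, ∀ u ∈ y, u ∈ z)%F
| ax_restricted_separation (x y z : nat) (p : formula C) :
    NoDup [x; y; z] -> restricted p = true -> ~ In z (fv p) ->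
    CZF_axiom (∃ z, (∀ y ∈ z, y ∈ x ∧ p) ∧ (∀ y ∈ x, p ⇒ y ∈ z))%F
| ax_subset_collection (a b c d u x y : nat) (p : formula C) :
    NoDup [a; b; c; d; u; x; y] -> ~ In c (fv p) -> ~ In d (fv p) ->
    CZF_axiom
      (∃ c, ∀ u, (∀ x ∈ a, ∃ y ∈ b, p) ⇒ (∃ d ∈ c, fprime x y p a d))%F
| ax_set_induction (x y : nat) (p : formula C) :
    NoDup [x; y] -> ~ In y (fv p) -> free_for x y p ->
    CZF_axiom ((∀ y, (∀ x ∈ y, p) ⇒ subst x y p) ⇒ (∀ x, p))%F
| ax_strong_collection (a b x y : nat) (p : formula C) :
    NoDup [a; b; x; y] -> ~ In b (fv p) ->
    CZF_axiom ((∀ x ∈ a, ∃ y, p) ⇒ (∃ b, fprime x y p a b))%F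
| ax_strong_infinity (w x y z : nat) :
    NoDup [w; x; y; z] ->
    CZF_axiom (∃ z, IsNat w x y z)%F.

(** * The interpretation

    An [L_V]-formula together with an assignment [rho] stands for the closed
    formula obtained by substituting the constant [rho x] for each free
    variable [x]; extending the assignment is substituting a constant. *)

Definition update {A : Type} (rho : nat -> A) (x : nat) (a : A) : nat -> A :=
  fun y => if Nat.eqb y x then a else rho y.

Definition interp_term {T : WeakTarskiUniverse} (rho : nat -> V T)
  (t : term (V T)) : V T :=
  match t with var x => rho x | cst alpha => alpha end.

Fixpoint interp {T : WeakTarskiUniverse} (rho : nat -> V T)
  (p : formula (V T)) {struct p} : Type :=
  match p with
  | feq s t => doteq (interp_term rho s) (interp_term rho t)
  | fmem s t =>
      {y : El (bar (interp_term rho t)) &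
        doteq (interp_term rho s) (tilde y)}
  | fbot => Empty_set
  | fconj q r => (interp rho q * interp rho r)%type
  | fdisj q r => (interp rho q + interp rho r)%type
  | fimp q r => interp rho q -> interp rho r
  | fall x q => forall alpha : V T, interp (update rho x alpha) q
  | fex x q => {alpha : V T & interp (update rho x alpha) q}
  | fballin x t q =>
      forall y : El (bar (interp_term rho t)),
        interp (update rho x (tilde y)) q
  | fbexin x t q =>
      {y : El (bar (interp_term rho t)) &
        interp (update rho x (tilde y)) q}
  end.

(** The universal closure is closed, so its interpretation does not depend on
    the assignment. *)
Definition valid {T : WeakTarskiUniverse} (p : formula (V T)) : Type :=
  forall rho : nat -> V T, interp rho (univ_closure p).

(* Main.v *)
Require Import Defs.
From Stdlib Require Import List PeanoNat CRelationClasses.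
From Stdlib Require Vectors.Fin.
Import ListNotations.

(** Extensionally equal assignments give logically equivalent interpretations,
    by induction on formulae.  The witnesses for the existential axioms are then
    read off from the data: since [Σ] comes with choice, a proof of
    [∀x∈a ∃y φ] is a function on [El a], which collects its own image (strong
    collection), and the functions between two sets are indexed by a name
    [π(a,b)] (subset collection).  Restricted formulae are logically equivalent
    to small types, so that separation is a small [Σ]-type.  A name enters an
    argument only through the surjectivity of the equivalence attached to it. *)

Set Implicit Arguments.
Unset Strict Implicit.

Local Arguments update {A} rho x a y /.

Lemma equiv_onto (A B : Type) (e : Equiv A B) (b : B) :
  {a : A & Id (projT1 e a) b}.
Proof.
  destruct e as [f [retr [h H]]]; exists (h b); apply H.
Qed.

Section Interpretation.

Context {T : WeakTarskiUniverse}.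
Implicit Types (alpha beta gamma : V T) (rho : nat -> V T)
  (p q : formula (V T)).

(** * Extensional equality and membership on [V] *)

Lemma doteq_refl alpha : doteq alpha alpha.
Proof.
  induction alpha as [a f IH]; split; intro x; exists x; apply IH.
Qed.

Lemma doteq_sym alpha beta : doteq alpha beta -> doteq beta alpha.
Proof.
  revert beta; induction alpha as [a f IH]; intros [b g] [H1 H2]; split.
  - intro y; destruct (H2 y) as [x Hx]; exists x; auto.
  - intro x; destruct (H1 x) as [y Hy]; exists y; auto.
Qed.

Lemma doteq_trans alpha beta gamma :
  doteq alpha beta -> doteq beta gamma -> doteq alpha gamma.
Proof.
  revert beta gamma; induction alpha as [a f IH].
  intros [b g] [c h] [H1 H2] [K1 K2]; split.
  - intro x; destruct (H1 x) as [y Hy]; destruct (K1 y) as [z Hz].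
    exists z; eauto.
  - intro z; destruct (K2 z) as [y Hy]; destruct (H2 y) as [x Hx].
    exists x; eauto.
Qed.

Lemma Id_doteq (A : Type) (f : A -> V T) (x y : A) :
  Id x y -> doteq (f x) (f y).
Proof. intros []; apply doteq_refl. Qed.

Definition mem alpha beta : Type :=
  {y : El (bar beta) & doteq alpha (tilde y)}.

Lemma mem_tilde alpha (i : El (bar alpha)) : mem (tilde i) alpha.
Proof. exists i; apply doteq_refl. Qed.

Lemma doteq_mem alpha beta (H : doteq alpha beta) (i : El (bar alpha)) :
  mem (tilde i) beta.
Proof. destruct alpha, beta; apply H. Qed.

Lemma mem_doteq_l alpha beta gamma :
  doteq alpha beta -> mem beta gamma -> mem alpha gamma.
Proof. intros H [y Hy]; exists y; eapply doteq_trans; eauto. Qed.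

Lemma mem_doteq_r alpha beta gamma :
  doteq beta gamma -> mem alpha beta -> mem alpha gamma.
Proof.
  intros H [y Hy]; apply (mem_doteq_l Hy); apply (doteq_mem H).
Qed.

Lemma doteq_of_incl alpha beta :
  (forall i : El (bar alpha), mem (tilde i) beta) ->
  (forall j : El (bar beta), mem (tilde j) alpha) -> doteq alpha beta.
Proof.
  destruct alpha as [a f], beta as [b g]; intros H K; split; [exact H|].
  intro y; destruct (K y) as [x Hx]; exists x; now apply doteq_sym.
Qed.

(** * Invariance of the interpretation under extensional equality *)

Lemma ball_iff alpha beta (P Q : V T -> Type) :
  doteq alpha beta ->
  (forall x y, doteq x y -> iffT (P x) (Q y)) ->
  iffT (forall i : El (bar alpha), P (tilde i))
       (forall j : El (bar beta), Q (tilde j)).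
Proof.
  intros E H; split; intros K i.
  (* [K] speaks of elements of [alpha], so the given element of [beta] is first traced back to an
     equal one there. *)
  - destruct (doteq_mem (doteq_sym E) i) as [j Hj].
    exact (fst (H _ _ (doteq_sym Hj)) (K j)).
  - destruct (doteq_mem E i) as [j Hj]; exact (snd (H _ _ Hj) (K j)).
Qed.

Lemma bex_iff alpha beta (P Q : V T -> Type) :
  doteq alpha beta ->
  (forall x y, doteq x y -> iffT (P x) (Q y)) ->
  iffT {i : El (bar alpha) & P (tilde i)} {j : El (bar beta) & Q (tilde j)}.
Proof.
  intros E H; split; intros [i K].
  - destruct (doteq_mem E i) as [j Hj].
    exists j; exact (fst (H _ _ Hj) K).
  - destruct (doteq_mem (doteq_sym E) i) as [j Hj].
    exists j; exact (snd (H _ _ (doteq_sym Hj)) K).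
Qed.

Lemma all_iff (P Q : V T -> Type) :
  (forall x y, doteq x y -> iffT (P x) (Q y)) ->
  iffT (forall x, P x) (forall x, Q x).
Proof.
  intro H; split; intros K x; apply (H x x (doteq_refl x)); apply K.
Qed.

Lemma ex_iff (P Q : V T -> Type) :
  (forall x y, doteq x y -> iffT (P x) (Q y)) ->
  iffT {x : V T & P x} {x : V T & Q x}.
Proof.
  intro H; split; intros [x K]; exists x; now apply (H x x (doteq_refl x)).
Qed.

Lemma doteq_iff alpha beta alpha' beta' :
  doteq alpha alpha' -> doteq beta beta' ->
  iffT (doteq alpha beta) (doteq alpha' beta').
Proof.
  intros H K; split; intro E.
  - exact (doteq_trans (doteq_sym H) (doteq_trans E K)).
  - exact (doteq_trans H (doteq_trans E (doteq_sym K))).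
Qed.

Lemma mem_iff alpha beta alpha' beta' :
  doteq alpha alpha' -> doteq beta beta' ->
  iffT (mem alpha beta) (mem alpha' beta').
Proof.
  intros H K; split; intro E.
  - exact (mem_doteq_l (doteq_sym H) (mem_doteq_r K E)).
  - exact (mem_doteq_l H (mem_doteq_r (doteq_sym K) E)).
Qed.

Lemma interp_term_ext rho rho' (t : term (V T)) :
  (forall n, In n (fv_term t) -> doteq (rho n) (rho' n)) ->
  doteq (interp_term rho t) (interp_term rho' t).
Proof.
  destruct t; intro H; [apply H; now left | apply doteq_refl].
Qed.

Lemma update_ext rho rho' (x : nat) (l : list nat) :
  (forall n, In n (remove Nat.eq_dec x l) -> doteq (rho n) (rho' n)) ->
  forall alpha beta, doteq alpha beta ->
  forall n, In n l -> doteq (update rho x alpha n) (update rho' x beta n).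
Proof.
  intros H alpha beta E n Hn; cbn.
  destruct (Nat.eqb_spec n x); [assumption|].
  apply H; now apply in_in_remove.
Qed.

(** Agreement is asked only on free variables and only up to [doteq]. One statement thus covers both
    replacing a value by an equal one and changing the value of a variable that is not free in
    [p]. *)
Lemma interp_ext_iff p rho rho' :
  (forall n, In n (fv p) -> doteq (rho n) (rho' n)) ->
  iffT (interp rho p) (interp rho' p).
Proof.
  revert rho rho'; induction p; intros rho rho' H; cbn in H |- *;
    (* Where the free variables form a concatenation, [H] is split into its two halves. *)
    try (assert (H1 := fun n h => H n (in_or_app _ _ n (or_introl h)));
         assert (H2 := fun n h => H n (in_or_app _ _ n (or_intror h)));
         cbn beta in H1, H2);
    try (specialize (IHp1 _ _ H1); specialize (IHp2 _ _ H2)).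
  - apply doteq_iff; now apply interp_term_ext.
  - apply mem_iff; now apply interp_term_ext.
  - now split.
  - destruct IHp1, IHp2; split; intros []; auto.
  - destruct IHp1, IHp2; split; intros []; auto.
  - destruct IHp1, IHp2; split; auto.
  - apply (all_iff (P := fun a => interp (update rho x a) p)
             (Q := fun a => interp (update rho' x a) p)).
    intros; apply IHp; now apply update_ext.
  - apply (ex_iff (P := fun a => interp (update rho x a) p)
             (Q := fun a => interp (update rho' x a) p)).
    intros; apply IHp; now apply update_ext.
  - apply (ball_iff (P := fun a => interp (update rho x a) p)
             (Q := fun a => interp (update rho' x a) p));
      [now apply interp_term_ext|].
    intros; apply IHp; now apply update_ext.
  - apply (bex_iff (P := fun a => interp (update rho x a) p)
             (Q := fun a => interp (update rho' x a) p));
      [now apply interp_term_ext|].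
    intros; apply IHp; now apply update_ext.
Qed.

Lemma interp_ext p rho rho' :
  interp rho p -> (forall n, In n (fv p) -> doteq (rho n) (rho' n)) ->
  interp rho' p.
Proof. intros K H; exact (fst (interp_ext_iff H) K). Qed.

(** * Substitution of variables *)

Lemma not_free_free_for (C : Type) (x y : nat) (p : formula C) :
  ~ In x (fv p) -> free_for x y p.
Proof.
  induction p; cbn; rewrite ?in_app_iff; tauto.
Qed.

Lemma interp_subst_term (x y : nat) (t : term (V T)) rho rho' :
  (forall n, In n (fv_term t) ->
     doteq (rho (if Nat.eqb n x then y else n)) (rho' n)) ->
  doteq (interp_term rho (subst_term x y t)) (interp_term rho' t).
Proof.
  destruct t as [n|]; intro H; cbn; [|apply doteq_refl].
  specialize (H n (or_introl eq_refl)); now destruct (Nat.eqb n x).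
Qed.

(** The step under a binder, with the induction hypothesis as a premise so that all four quantifiers
    share it. *)
Lemma interp_subst_bound (x y z : nat) q rho rho' :
  (free_for x y q -> forall rho rho',
     (forall n, In n (fv q) ->
        doteq (rho (if Nat.eqb n x then y else n)) (rho' n)) ->
     iffT (interp rho (subst x y q)) (interp rho' q)) ->
  ~ In x (remove Nat.eq_dec z (fv q)) \/ (z <> y /\ free_for x y q) ->
  (forall n, In n (remove Nat.eq_dec z (fv q)) ->
     doteq (rho (if Nat.eqb n x then y else n)) (rho' n)) ->
  forall alpha beta, doteq alpha beta ->
  iffT (interp (update rho z alpha) (if Nat.eqb z x then q else subst x y q))
       (interp (update rho' z beta) q).
Proof.
  intros IH Hf H alpha beta E.
  destruct (Nat.eqb_spec z x) as [->|zx].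
  (* The binder is [x] itself: substitution stops here, and [x] is not among the variables still
     free. *)
  - apply interp_ext_iff; apply update_ext; [|exact E].
    intros n Hn; specialize (H n Hn).
    destruct (Nat.eqb_spec n x) as [nx|]; [subst n | exact H].
    exfalso; exact (remove_In _ _ _ Hn).
  - apply IH.
    + destruct Hf as [Hf|[_ Hf]]; [|exact Hf].
      apply not_free_free_for; intro Hx; apply Hf; apply in_in_remove; auto.
    + intros n Hn; cbn; destruct (Nat.eqb_spec n z) as [->|nz].
      * apply Nat.eqb_neq in zx; now rewrite zx, Nat.eqb_refl.
      * assert (Hr : In n (remove Nat.eq_dec z (fv q)))
          by now apply in_in_remove.
        specialize (H n Hr); destruct (Nat.eqb_spec n x) as [nx|nx].
        (* If [y] were the binder [z], it would be captured; [free_for] excludes this, since [x] is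
           free in the body. *)
        -- subst n; destruct (Nat.eqb_spec y z) as [yz|]; [subst y | exact H].
           exfalso; destruct Hf as [|[]]; auto.
        -- apply Nat.eqb_neq in nz; now rewrite nz.
Qed.

(** Relating two arbitrary assignments, rather than [rho] and one fixed update of it, gives a form
    that survives extending both at a bound variable. *)
Lemma interp_subst (x y : nat) p (Hf : free_for x y p) rho rho' :
  (forall n, In n (fv p) ->
     doteq (rho (if Nat.eqb n x then y else n)) (rho' n)) ->
  iffT (interp rho (subst x y p)) (interp rho' p).
Proof.
  revert Hf rho rho'; induction p; intros Hf rho rho' H; cbn in Hf, H |- *;
    try (assert (H1 := fun n h => H n (in_or_app _ _ n (or_introl h)));
         assert (H2 := fun n h => H n (in_or_app _ _ n (or_intror h)));
         cbn beta in H1, H2);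
    try (specialize (IHp1 (proj1 Hf) _ _ H1);
         specialize (IHp2 (proj2 Hf) _ _ H2)).
  - apply doteq_iff; now apply interp_subst_term.
  - apply mem_iff; now apply interp_subst_term.
  - now split.
  - destruct IHp1, IHp2; split; intros []; auto.
  - destruct IHp1, IHp2; split; intros []; auto.
  - destruct IHp1, IHp2; split; auto.
  - apply (all_iff (Q := fun a => interp (update rho' x0 a) p)
        (P := fun a => interp (update rho x0 a)
                         (if Nat.eqb x0 x then p else subst x y p))).
    now apply interp_subst_bound.
  - apply (ex_iff (Q := fun a => interp (update rho' x0 a) p)
        (P := fun a => interp (update rho x0 a)
                         (if Nat.eqb x0 x then p else subst x y p))).
    now apply interp_subst_bound.
  - apply (ball_iff (Q := fun a => interp (update rho' x0 a) p)
        (P := fun a => interp (update rho x0 a)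
                         (if Nat.eqb x0 x then p else subst x y p)));
      [now apply interp_subst_term|].
    now apply interp_subst_bound.
  - apply (bex_iff (Q := fun a => interp (update rho' x0 a) p)
        (P := fun a => interp (update rho x0 a)
                         (if Nat.eqb x0 x then p else subst x y p)));
      [now apply interp_subst_term|].
    now apply interp_subst_bound.
Qed.

(** * Types logically equivalent to a named type *)

Definition small (A : Type) : Type := {a : U T & iffT (El a) A}.

Lemma small_iff (A B : Type) : iffT A B -> small A -> small B.
Proof. intros [f g] [a [h k]]; exists a; split; auto. Qed.

Lemma small_El (a : U T) : small (El a).
Proof. exists a; split; auto. Qed.

Lemma small_equiv (a : U T) (A : Type) (e : Equiv (El a) A) : small A.
Proof.
  exists a; split; [exact (projT1 e)|].
  intro x; exact (projT1 (equiv_onto e x)).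
Qed.

Lemma small_forall (a : U T) (B : El a -> Type) :
  (forall x, small (B x)) -> small (forall x, B x).
Proof.
  intro H; refine (small_iff _ (small_equiv (El_pi (fun x => projT1 (H x))))).
  split; intros K x; now apply (projT2 (H x)).
Qed.

Lemma small_exists (a : U T) (B : El a -> Type) :
  (forall x, small (B x)) -> small {x : El a & B x}.
Proof.
  intro H.
  refine (small_iff _ (small_equiv (El_sigma (fun x => projT1 (H x))))).
  split; intros [x K]; exists x; now apply (projT2 (H x)).
Qed.

(** There is no separate name for products: one takes [sigma_] over a constant family, and likewise
    [pi_] for arrows. *)
Lemma small_prod (A B : Type) : small A -> small B -> small (A * B).
Proof.
  intros [a [f g]] [b [h k]].
  refine (small_iff _ (small_exists (a := a) (fun _ => small_El b))).
  split; [intros [x y] | intros [x y]; exists (g x)]; auto.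
Qed.

Lemma small_arrow (A B : Type) : small A -> small B -> small (A -> B).
Proof.
  intros [a [f g]] [b [h k]].
  refine (small_iff _ (small_forall (a := a) (fun _ => small_El b))).
  split; auto.
Qed.

Lemma small_sum (A B : Type) : small A -> small B -> small (A + B).
Proof.
  intros [a [f g]] [b [h k]].
  refine (small_iff _ (small_equiv (El_plus a b))).
  split; intros []; auto.
Qed.

Lemma small_empty : small Empty_set.
Proof.
  refine (small_iff _ (small_equiv (El_fin T 0))).
  split; [apply Fin.case0 | intros []].
Qed.

(** Each unfolding of [doteq] quantifies only over [El a] and [El b], so induction on [V] builds the
    name. *)
Lemma small_doteq alpha beta : small (doteq alpha beta).
Proof.
  revert beta; induction alpha as [a f IH]; intros [b g].
  apply small_prod; apply small_forall; intro; apply small_exists; auto.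
Qed.

Lemma small_restricted p : restricted p = true ->
  forall rho, small (interp rho p).
Proof.
  induction p; cbn; intros H rho; try discriminate H;
    try (apply Bool.andb_true_iff in H; destruct H).
  - apply small_doteq.
  - apply small_exists; intro; apply small_doteq.
  - apply small_empty.
  - apply small_prod; auto.
  - apply small_sum; auto.
  - apply small_arrow; auto.
  - apply small_forall; auto.
  - apply small_exists; auto.
Qed.

(** * Sets indexed through an equivalence; the numerals and [omega] *)

Definition family (a : U T) (A : Type) (e : Equiv (El a) A) (f : A -> V T) :
  V T := sup a (fun i => f (projT1 e i)).

(** Some index decodes to [x] up to [Id], and every [P] can be transported along [Id]. *)
Lemma family_ex (a : U T) (A : Type) (e : Equiv (El a) A) (f : A -> V T)
  (P : V T -> Type) (x : A) :
  P (f x) -> {i : El (bar (family e f)) & P (tilde i)}.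
Proof.
  intro H; destruct (equiv_onto e x) as [i E]; exists i; now destruct E.
Qed.

Lemma family_mem (a : U T) (A : Type) (e : Equiv (El a) A) (f : A -> V T)
  (x : A) : mem (f x) (family e f).
Proof. apply family_ex with (x := x); apply doteq_refl. Qed.

Lemma family_all (a : U T) (A : Type) (e : Equiv (El a) A) (f : A -> V T)
  (P : V T -> Type) :
  (forall x, P (f x)) -> forall i : El (bar (family e f)), P (tilde i).
Proof. intros H i; apply H. Qed.

(** The von Neumann numerals: the successor adjoins [numeral k] to its own elements, the new element
    being indexed by the one-element summand. *)
Fixpoint numeral (k : nat) : V T :=
  match k with
  | 0 => family (El_fin T 0) (Fin.case0 (fun _ => V T))
  | S k =>
      family (El_plus (bar (numeral k)) (fin_ T 1))
        (fun s => match s with inl i => tilde i | inr _ => numeral k end)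
  end.

Definition omega : V T := family (El_n T) numeral.

(** What [Succ] becomes under [interp] once variable lookups are computed. *)
Definition is_succ alpha beta : Type :=
  (forall i : El (bar alpha), mem (tilde i) beta) * (mem alpha beta *
  (forall j : El (bar beta), mem (tilde j) alpha + doteq (tilde j) alpha)).

Lemma numeral_zero : El (bar (numeral 0)) -> Empty_set.
Proof. intro i; exact (Fin.case0 (fun _ => Empty_set) (projT1 (El_fin T 0) i)). Qed.

Lemma numeral_succ (k : nat) : is_succ (numeral k) (numeral (S k)).
Proof.
  repeat split.
  - intro i; exact (family_mem (El_plus _ _) _ (inl i)).
  - exact (family_mem (El_plus _ _) _
             (inr (projT1 (equiv_onto (El_fin T 1) Fin.F1)))).
  - apply (family_all
             (P := fun v => (mem v (numeral k) + doteq v (numeral k))%type)).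
    intros [i|i]; [left; apply mem_tilde | right; apply doteq_refl].
Qed.

(** Each quantifier of the closure merely updates the assignment, so truth under all assignments is
    preserved. *)
Lemma valid_of_interp p : (forall rho, interp rho p) -> valid p.
Proof.
  intros H rho; unfold univ_closure; revert rho.
  induction (nodup Nat.eq_dec (fv p)) as [|x l IH]; cbn; auto.
Qed.

End Interpretation.

(** * Tactics for variable names *)

Local Ltac distinct H :=
  rewrite ?NoDup_cons_iff in H; cbn [In] in H.

Local Ltac lookup :=
  cbn;
  repeat (rewrite Nat.eqb_refl ||
    match goal with
    | |- context [Nat.eqb ?x ?y] =>
        replace (Nat.eqb x y) with false
          by (symmetry; apply Nat.eqb_neq; intuition congruence)
    end).

(** Compares names case by case; the impossible cases contradict distinctness of the variables or
    freshness for [p]. *)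
Local Ltac agree :=
  let n := fresh "n" in
  let Hn := fresh "Hn" in
  intros n Hn; cbn;
  repeat match goal with
    | |- context [Nat.eqb ?x ?y] => destruct (Nat.eqb_spec x y)
    end;
  try apply doteq_refl; try assumption;
  exfalso; subst; intuition congruence.

(** * Validity of the individual axioms *)

Section Validity.

Context {T : WeakTarskiUniverse}.
Implicit Types (rho : nat -> V T) (p : formula (V T)).

Lemma interp_forall_in (x y : nat) p rho : NoDup [x; y] ->
  interp rho ((∀ x ∈ y, p) ⇔ (∀ x, x ∈ y ⇒ p))%F.
Proof.
  intro D; distinct D; lookup; split.
  (* Membership yields [alpha] only up to [doteq]; invariance carries [p] over from [tilde i]. *)
  - intros H alpha [i E]; refine (interp_ext (H i) _); apply doteq_sym in E.
    agree.
  - intros H i; apply H; apply mem_tilde.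
Qed.

Lemma interp_exists_in (x y : nat) p rho : NoDup [x; y] ->
  interp rho ((∃ x ∈ y, p) ⇔ (∃ x, x ∈ y ∧ p))%F.
Proof.
  intro D; distinct D; lookup; split.
  - intros [i H]; exists (tilde i); split; [apply mem_tilde | exact H].
  - intros [alpha [[i E] H]]; exists i; refine (interp_ext H _); agree.
Qed.

Lemma interp_extensionality (x y z : nat) rho : NoDup [x; y; z] ->
  interp rho (x ≐ y ⇔ (∀ z, z ∈ x ⇔ z ∈ y))%F.
Proof.
  intro D; distinct D; lookup; split.
  - intros E alpha; split; apply mem_doteq_r; [|apply doteq_sym]; exact E.
  - intro H; apply doteq_of_incl; intro i; apply H; apply mem_tilde.
Qed.

Lemma interp_eq_mem (x y z : nat) rho :
  interp rho (x ≐ y ∧ y ∈ z ⇒ x ∈ z)%F.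
Proof. intros [E H]; exact (mem_doteq_l E H). Qed.

Lemma interp_pairing (x y z : nat) rho : NoDup [x; y; z] ->
  interp rho (∃ z, x ∈ z ∧ y ∈ z)%F.
Proof.
  intro D; distinct D.
  exists (family (El_fin T 2)
            (fun i => Fin.caseS' i (fun _ => V T) (rho x) (fun _ => rho y))).
  lookup; split.
  - exact (family_mem _ _ Fin.F1).
  - exact (family_mem _ _ (Fin.FS Fin.F1)).
Qed.

Lemma interp_union (x y z u : nat) rho : NoDup [x; y; z; u] ->
  interp rho (∃ z, ∀ y ∈ x, ∀ u ∈ y, u ∈ z)%F.
Proof.
  intro D; distinct D.
  (* An element of the union is indexed by an index into [x] and an index into the element found
     there. *)
  exists (family (El_sigma (fun i : El (bar (rho x)) => bar (tilde i)))
            (fun s => tilde (projT2 s))).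
  lookup; intros i j.
  exact (family_mem _ _ (existT _ i j)).
Qed.

Lemma interp_restricted_separation (x y z : nat) p rho :
  NoDup [x; y; z] -> restricted p = true -> ~ In z (fv p) ->
  interp rho (∃ z, (∀ y ∈ z, y ∈ x ∧ p) ∧ (∀ y ∈ x, p ⇒ y ∈ z))%F.
Proof.
  intros D R F; distinct D.
  (* [c i] holds a name for [p] at the element [i] of [x]; the separated set [Z] is indexed by
     elements paired with an inhabitant of that name. *)
  pose (c := fun i : El (bar (rho x)) =>
               small_restricted R (update rho y (tilde i))).
  pose (Z := family (El_sigma (fun i => projT1 (c i)))
               (fun s => tilde (projT1 s))).
  exists Z; lookup; split.
  - apply (family_all (P := fun v =>
             (mem v (rho x) * interp (update (update rho z Z) y v) p)%type)).
    intros [i H]; split; [apply mem_tilde|].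
    (* The name was formed before [z] received the value [Z], which is harmless as [z] is not free
       in [p]. *)
    refine (interp_ext (fst (projT2 (c i)) H) _); agree.
  - intros i H.
    refine (family_mem _ _ (existT _ i (snd (projT2 (c i)) _))).
    refine (interp_ext H _); agree.
Qed.

Lemma interp_subset_collection (a b c d u x y : nat) p rho :
  NoDup [a; b; c; d; u; x; y] -> ~ In c (fv p) -> ~ In d (fv p) ->
  interp rho
    (∃ c, ∀ u, (∀ x ∈ a, ∃ y ∈ b, p) ⇒ (∃ d ∈ c, fprime x y p a d))%F.
Proof.
  intros D Fc Fd; distinct D.
  (* The set of images of all functions from the indices of [a] to those of [b]; it is fixed before
     [u] is chosen. *)
  exists (family (El_pi (fun _ : El (bar (rho a)) => bar (rho b)))
            (fun f => sup (bar (rho a)) (fun i => tilde (f i)))).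
  intro alpha; lookup; intro H.
  (* The hypothesis is itself a choice function; [g] is its code. *)
  destruct (equiv_onto (El_pi (fun _ : El (bar (rho a)) => bar (rho b)))
              (fun i => projT1 (H i))) as [g E].
  exists g; cbn; lookup.
  (* [g] decodes to the choice function only up to [Id], hence its values give elements equal up to
     [doteq]. *)
  assert (K := fun i => doteq_sym (Id_doteq (@tilde T (rho b)) (happly E i))).
  split; intro i; exists i; specialize (K i);
    refine (interp_ext (projT2 (H i)) _); agree.
Qed.

Lemma interp_set_induction (x y : nat) p rho :
  NoDup [x; y] -> ~ In y (fv p) -> free_for x y p ->
  interp rho ((∀ y, (∀ x ∈ y, p) ⇒ subst x y p) ⇒ (∀ x, p))%F.
Proof.
  intros D F Hf; distinct D; lookup; intros H alpha.
  induction alpha as [a f IH].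
  (* The premise at [y] equal to [sup a f] yields the substituted formula, which [interp_subst]
     reads as [p] with [x] equal to [sup a f]. *)
  refine (fst (interp_subst Hf _) (H (sup a f) _)).
  - agree.
  - intro i; refine (interp_ext (IH i) _); agree.
Qed.

Lemma interp_strong_collection (a b x y : nat) p rho :
  NoDup [a; b; x; y] -> ~ In b (fv p) ->
  interp rho ((∀ x ∈ a, ∃ y, p) ⇒ (∃ b, fprime x y p a b))%F.
Proof.
  intros D F; distinct D; lookup; intro H.
  exists (sup (bar (rho a)) (fun i => projT1 (H i))); cbn; lookup.
  (* The image is indexed by the indices of [a], so the same [i] answers both halves of [fprime]. *)
  split; intro i; exists i; refine (interp_ext (projT2 (H i)) _); agree.
Qed.

Lemma interp_strong_infinity (w x y z : nat) rho : NoDup [w; x; y; z] ->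
  interp rho (∃ z, IsNat w x y z)%F.
Proof.
  intro D; distinct D; exists omega; lookup.
  (* The predicates below are the clauses of [IsNat] with lookups computed; each is checked on
     numerals and passed to indices of [omega]. *)
  split; [|split].
  - refine (family_all (P := fun v => ((El (bar v) -> Empty_set) +
              {j : El (bar omega) & is_succ (tilde j) v})%type) _).
    intros [|k]; [left; exact numeral_zero | right].
    exact (family_ex (El_n T) (P := fun v => is_succ v _) (numeral_succ k)).
  - exact (family_ex (El_n T) (P := fun v => El (bar v) -> Empty_set)
             numeral_zero).
  - refine (family_all
              (P := fun v => {j : El (bar omega) & is_succ v (tilde j)}) _).
    intro k; exact (family_ex (El_n T) (P := is_succ _) (numeral_succ k)).
Qed.

End Validity.

Theorem theorem6p7 (T : WeakTarskiUniverse) (fe : FunExt) (ua : Univalence T)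
  (p : formula (V T)) (hp : CZF_axiom p) : valid p.
Proof.
  apply valid_of_interp; intro rho; destruct hp.
  - now apply interp_forall_in.
  - now apply interp_exists_in.
  - now apply interp_extensionality.
  - now apply interp_eq_mem.
  - now apply interp_pairing.
  - now apply interp_union.
  - now apply interp_restricted_separation.
  - now apply interp_subset_collection.
  - now apply interp_set_induction.
  - now apply interp_strong_collection.
  - now apply interp_strong_infinity.
Qed.
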